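(* Let $M,m,n$ be integers with $1\le m<n\le M$, let $\rho>0$, let $0<a_2\le \tfrac12$, $a_1=1-a_2$, and $b_1=b_2=\tfrac12$. Let $|h_1|^2\le\cdots\le|h_M|^2$ be the order statistics of $M$ i.i.d. exponential random variables with mean $1$, and put $x=\rho|h_m|^2$, $y=\rho|h_n|^2$. Let $R_1^N=\log_2\left(1+\frac{a_1x}{1+a_2x}\right)$, $R_2^N=\log_2(1+a_2y)$ be the NOMA rates of users $m$ and $n$, and $R_1^T=b_1\log_2(1+x)$, $R_2^T=b_2\log_2(1+y)$ their TDMA rates. Then the probability that NOMA achieves larger individual rates than TDMA for both user $m$ and user $n$, i.e. $P(\varepsilon_2)=P\left(R_1^N>R_1^T,\ R_2^N>R_2^T\right)$, is $$P(\varepsilon_2)=w_1\sum_{k=0}^{m-1}\frac{(-1)^{m-1-k}C_{m-1}^k}{n-1-k}\left[\sum_{i=0}^{n-1}\frac{(-1)^{n-1-i}C_{n-1}^i d^{M-i}}{M-i}-\sum_{i=0}^{k}\sum_{j=0}^{n-1-k}\frac{(-1)^{n-1-i-j}C_k^iC_{n-1-k}^j d^{M-i}}{M-i-j}\right],$$ where $w_1=\frac{M!}{(m-1)!\,(n-1-m)!\,(M-n)!}$, $d=e^{-w_2/\rho}$ and $w_2=\frac{1-2a_2}{a_2^2}$.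
   Context: Here $C_p^q=\frac{p!}{q!(p-q)!}$ is the binomial coefficient. The setting is a downlink with $M$ users with Rayleigh fading channel gains ordered as $|h_1|^2\le\cdots\le|h_M|^2$; $\rho$ is the transmit signal-to-noise ratio. The pair $(x,y)$ has joint density, on $0<x<y$, $$f_{X,Y}(x,y)=w_1f(x)f(y)[F(x)]^{m-1}[1-F(y)]^{M-n}[F(y)-F(x)]^{n-1-m},$$ with $f(x)=\frac1\rho e^{-x/\rho}$ and $F(x)=1-e^{-x/\rho}$. The numbers $(a_1,a_2)$ are fixed NOMA power allocation coefficients with $a_1+a_2=1$ and $a_1\ge a_2$; $(b_1,b_2)$ are the TDMA time fractions. *)

(* Defs.v *)
From HB Require Import structures.
From mathcomp Require Import all_boot all_order all_algebra.
From mathcomp Require Import all_classical all_reals all_analysis.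

Set Implicit Arguments.
Unset Strict Implicit.
Unset Printing Implicit Defensive.

Import Order.TTheory GRing.Theory Num.Theory.

Local Open Scope classical_set_scope.
Local Open Scope ring_scope.

Definition log2 (R : realType) (x : R) : R := ln x / ln 2.

Section probability.
Context (d : measure_display) (T : measurableType d) (R : realType)
  (P : probability T R).

Definition mutually_independent (I : finType) (X : I -> {RV P >-> R}) : Prop :=
  forall (J : {set I}) (B : I -> set R), (forall i, measurable (B i)) ->
    P (\bigcap_(i in [set` J]) (X i @^-1` B i)) =
    (\prod_(i in J) P (X i @^-1` B i))%E.

(* The mean of the exponential law of rate r is 1/r, so mean 1 is rate 1. *)
Definition iid_exponential1 (I : finType) (X : I -> {RV P >-> R}) : Prop :=
  mutually_independent X /\
  forall i (B : set R), measurable B ->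
    distribution P (X i) B = exponential_prob 1 B.

(* k-th smallest of X_0, ..., X_(M-1); the rank k is 1-based, 1 <= k <= M, and
   k = 0 or k > M yields a junk value. *)
Definition order_stat (M : nat) (X : 'I_M -> {RV P >-> R}) (k : nat) (t : T) : R :=
  nth 0 (sort <=%R [seq X i t | i <- enum 'I_M]) k.-1.

End probability.

(* User 1 is the weaker user (SNR x), who decodes treating the other user's
   signal as noise; user 2 (SNR y) first removes user 1's signal. *)
Definition noma_rate1 (R : realType) (a1 a2 x : R) : R :=
  log2 (1 + a1 * x / (1 + a2 * x)).

Definition noma_rate2 (R : realType) (a2 y : R) : R := log2 (1 + a2 * y).

Definition tdma_rate (R : realType) (b x : R) : R := b * log2 (1 + x).

(* The natural-number subtractions below are never truncated when
   1 <= m < n <= M. *)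
Definition w1 (R : realType) (M m n : nat) : R :=
  (M`!)%:R / (((m - 1)`!)%:R * ((n - 1 - m)`!)%:R * ((M - n)`!)%:R).

Definition w2 (R : realType) (a2 : R) : R := (1 - 2 * a2) / a2 ^+ 2.

(* Main.v *)
(* Since a_1 + a_2 = 1, the two rate conditions reduce, for x, y > 0, to x < w_2 and y > w_2. Writing c = w_2 / rho, the event is therefore almost surely that the number of gains at most c lies in [m, n), which by independence has probability sum_(m <= l < n) C(M, l) (1 - d)^l d^(M - l).

The closed form is matched with this binomial sum as an identity of polynomials in d: both sides vanish at d = 0, and both derivatives equal n C(M, n) (1 - d)^(n-1) d^(M-n) - m C(M, m) (1 - d)^(m-1) d^(M-m). On the left the derivative telescopes; on the right the inner sums are the integrals over [0, d] of t^(M-n) (1-t)^(n-1) and t^(M-n) (1-t)^k (d-t)^(n-1-k), and their alternating sums over k collapse by the binomial theorem to Beta integrals. *)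
Require Import Defs.
From HB Require Import structures.
From mathcomp Require Import all_boot all_order all_algebra.
From mathcomp Require Import all_classical all_reals all_analysis.
From mathcomp Require Import measurable_realfun ring lra zify.

Set Implicit Arguments.
Unset Strict Implicit.
Unset Printing Implicit Defensive.

Import Order.TTheory GRing.Theory Num.Theory.

Local Open Scope classical_set_scope.
Local Open Scope ring_scope.

(** * Counting in sorted lists and among subsets of given size *)

Lemma nth_sort_le (R : realType) (s : seq R) (k : nat) (c : R) :
  (0 < k)%N -> (k <= size s)%N ->
  (nth 0 (sort <=%R s) k.-1 <= c)%R = (k <= count (fun z => (z <= c)%R) s)%N.
Proof.
case: k => //= k _ ks.
have ss : sorted <=%R (sort <=%R s) by exact: sort_le_sorted.
(* Sorting preserves the count, and in the sorted list the entries at most [c] form an initial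
   segment of that length. *)
have cs : count (fun z => (z <= c)%R) s = count (<= c) (sort <=%R s).
  by apply/permP; rewrite perm_sym perm_sort.
rewrite cs; apply/idP/idP => [|h]; last exact: nth_count_le.
apply: contraTT; rewrite -leqNgt -ltNge => h.
by apply: nth_count_gt => //; rewrite h size_sort.
Qed.

Lemma sum_set_card (R : nmodType) (I : finType) (F : nat -> R) (m n : nat) :
  (n <= #|I|.+1)%N ->
  \sum_(S : {set I} | (m <= #|S| < n)%N) F #|S|
  = \sum_(m <= l < n) F l *+ 'C(#|I|, l).
Proof.
move=> nI; pose N := #|I|.+1.
(* Subsets are grouped by size. Since [#|S| <= #|I|], [inord] into ['I_N] loses nothing, and the
   fibre over [l] has ['C(#|I|, l)] elements. *)
rewrite (partition_big (fun S : {set I} => inord #|S| : 'I_N)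
  (fun l : 'I_N => (m <= l < n)%N)) /=; last first.
  by move=> S; rewrite inordK// /N ltnS max_card.
rewrite big_nat_cond (big_nat_widen _ _ N)// (big_nat_widenl _ 0)// big_mkord.
apply: eq_big => [l|l].
  by have := ltn_ord l; lia.
move=> ml; rewrite -card_draws -sumr_const; apply: congr_big => // [S|S].
  rewrite inE; apply/andP/eqP => [[_ /eqP <-]|lS].
    by rewrite inordK// ltnS max_card.
  by rewrite lS; split=> //; apply/eqP/val_inj; rewrite /= inordK.
by case/andP => _ /eqP <-; rewrite inordK// ltnS max_card.
Qed.

(** * Order statistics through the random set of gains below a threshold *)

Section OrderStatistics.
Context (disp : measure_display) (T : measurableType disp) (R : realType).

Lemma le_measure_ae (mu : measure T R) (A B : set T) :
  measurable A -> measurable B -> {ae mu, forall t, A t -> B t} ->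
  (mu A <= mu B)%E.
Proof.
move=> mA mB [N [mN N0 sN]]; rewrite -(measureU0 mB mN N0).
apply: le_measure; rewrite ?inE//; first exact: measurableU.
by move=> t At; have [Bt|nBt] := pselect (B t); [left|right; apply: sN => /(_ At)].
Qed.

Lemma measure_ae_eq (mu : measure T R) (A B : set T) :
  measurable A -> measurable B -> {ae mu, forall t, A t <-> B t} ->
  mu A = mu B.
Proof.
move=> mA mB AB; apply/eqP; rewrite eq_le; apply/andP; split;
  by apply: le_measure_ae => //; apply: filterS AB => t [].
Qed.

(** Squaring makes the base nonnegative, so that [powR] with exponent -1 is the inverse there; the
    resulting formula for [f^-1] also holds at zeros of [f], where both sides are 0. *)
Lemma measurable_fun_inv (f : T -> R) :
  measurable_fun setT f -> measurable_fun setT (fun t => (f t)^-1).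
Proof.
move=> mf.
have -> : (fun t => (f t)^-1) = (fun t => f t * (f t ^+ 2) `^ (-1)).
  apply/funext => t; rewrite powR_inv1 ?sqr_ge0// expr2 invfM mulrA.
  by have [->|f0] := eqVneq (f t) 0; rewrite ?invr0 ?mul0r// divff// mul1r.
apply: measurable_funM => //.
apply: (measurableT_comp (measurable_powR (-1))).
exact: measurable_funX.
Qed.

Variables (P : probability T R) (M : nat) (G : 'I_M -> {RV P >-> R}).

(** Comparing an order statistic with [c] depends only on the size of this random set, whose law
    follows from independence. *)
Definition below (c : R) (t : T) : {set 'I_M} := [set i | G i t <= c]%SET.

Definition cell_itv (c : R) (S : {set 'I_M}) (i : 'I_M) : set R :=
  if i \in S then `]-oo, c]%classic else ~` `]-oo, c].

(** Fixing the whole set, not just its size, gives an intersection of one condition per gain, the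
    form in which independence applies. *)
Lemma below_cell c S :
  [set t | below c t = S] = \bigcap_(i in [set` [set: 'I_M]%SET]) (G i @^-1` cell_itv c S i).
Proof.
apply/seteqP; split => [t /= <- i _|t tS] /=.
  by rewrite /cell_itv inE; case: ifPn => //= /negP Gic; rewrite in_itv/=.
apply/setP => i; have := tS i; rewrite /= !inE /cell_itv => /(_ isT).
by case: ifPn => _ /=; rewrite in_itv//= => /negP/negbTE.
Qed.

Lemma measurable_cell_itv c S i : measurable (cell_itv c S i).
Proof. by rewrite /cell_itv; case: ifP => _ //; exact: measurableC. Qed.

Lemma measurable_below c S : measurable [set t | below c t = S].
Proof.
rewrite below_cell; apply: fin_bigcap_measurable; first exact: finite_finset.
move=> i _; rewrite -[_ @^-1` _]setTI; apply: measurable_funPT => //.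
exact: measurable_cell_itv.
Qed.

Lemma below_bigcup c (Q : pred {set 'I_M}) :
  [set t | Q (below c t)] = \bigcup_(S in [set` Q]) [set t | below c t = S].
Proof.
apply/seteqP; split => [t /= Qt|t [S /= QS eS]]; first by exists (below c t).
by rewrite eS.
Qed.

Lemma measurable_belowP c (Q : pred {set 'I_M}) : measurable [set t | Q (below c t)].
Proof.
rewrite below_bigcup; apply: fin_bigcup_measurable; first exact: finite_finset.
by move=> S _; exact: measurable_below.
Qed.

Lemma order_stat_le k c t : (0 < k)%N -> (k <= M)%N ->
  (order_stat G k t <= c) = (k <= #|below c t|)%N.
Proof.
move=> k0 kM.
have -> : #|below c t| = count (fun i => (G i t <= c)%R) (enum 'I_M).
  by rewrite enumT cardE /enum_mem size_filter; apply: eq_count => i /=; rewrite inE.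
rewrite /order_stat nth_sort_le ?count_map//.
by rewrite size_map size_enum_ord.
Qed.

Lemma measurable_order_stat k : (0 < k)%N -> (k <= M)%N ->
  measurable_fun setT (order_stat G k).
Proof.
move=> k0 kM mD; apply: (measurability _ (RGenOInfty.measurableE R)) => //.
move=> /= _ [_ [a ->] <-]; rewrite setTI.
rewrite [X in measurable X](_ : _ = [set t | (#|below a t| < k)%N]).
  exact: (measurable_belowP a (fun S => #|S| < k)%N).
by apply/seteqP; split => t /=; rewrite in_itv/= andbT ltNge order_stat_le// -ltnNge.
Qed.

(** This transfers almost sure properties of all the gains to the order statistics. *)
Lemma order_stat_mem k t : (0 < k)%N -> (k <= M)%N ->
  exists i, order_stat G k t = G i t.
Proof.
case: k => //= k _ kM.
have : order_stat G k.+1 t \in [seq G i t | i <- enum 'I_M].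
  by rewrite -(mem_sort <=%R) mem_nth// size_sort size_map size_enum_ord.
by case/mapP => i _ ->; exists i.
Qed.

(** The cells [below c t = S] are disjoint; independence makes each a product, with a factor [p] for
    each index in [S] and [1 - p] for each index outside. *)
Lemma probability_below (c p : R) (Q : pred {set 'I_M}) :
  mutually_independent G -> (forall i, P (G i @^-1` `]-oo, c]) = p%:E) ->
  P [set t | Q (below c t)] =
  (\sum_(S | Q S) p ^+ #|S| * (1 - p) ^+ (M - #|S|))%:E.
Proof.
move=> indG Gp.
have mG i : measurable (G i @^-1` `]-oo, c]).
  by rewrite -[_ @^-1` _]setTI; apply: measurable_funPT.
rewrite below_bigcup measure_fin_bigcup//=; last 2 first.
- by move=> S S' _ _ [t [/= <- <-]].
- by move=> S _; exact: measurable_below.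
rewrite (fsbigE (enum Q)) ?enum_uniq//; last 2 first.
- by move=> S /=; rewrite mem_enum.
- by move=> S /= QS; rewrite mem_enum QS.
rewrite big_enum_cond/= -sumEFin; apply: eq_big => [S|S _].
  by rewrite mem_setE andbb.
rewrite below_cell indG; last by move=> i; exact: measurable_cell_itv.
transitivity ((\prod_(i < M) (if i \in S then p else 1 - p))%:E).
  rewrite -prodEFin; apply: eq_big => [i|i _]; first by rewrite inE.
  rewrite /cell_itv; case: ifP => _ //.
  rewrite preimage_setC probability_setC ?Gp ?EFinB//.
  exact: mG.
congr (_%:E); rewrite (bigID (mem S))/=; congr (_ * _).
  by rewrite -prodr_const; apply: eq_bigr => i ->.
have -> : (M - #|S| = #|~: S|)%N by rewrite [RHS]cardsCs finset.setCK card_ord.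
rewrite -prodr_const; apply: eq_big => [i|i /negbTE ->//].
by rewrite inE.
Qed.

End OrderStatistics.

(** * The exponential law of mean 1 *)

Section Exponential.
Context (disp : measure_display) (T : measurableType disp) (R : realType).
Variables (P : probability T R) (X : {RV P >-> R}).
Hypothesis X_exp : forall B : set R, measurable B ->
  distribution P X B = exponential_prob 1 B.

Lemma exponential1_set1 a : P (X @^-1` [set a]) = 0.
Proof.
by rewrite -[LHS]/(distribution P X [set a]) X_exp// /exponential_prob integral_set1.
Qed.

Lemma exponential1_lt0 : P (X @^-1` `]-oo, 0[) = 0.
Proof.
rewrite -[LHS]/(distribution P X `]-oo, 0[%classic) X_exp// /exponential_prob.
apply: integral0_eq => x /=; rewrite in_itv/= => x0.
by rewrite lt0_exponential_pdf.
Qed.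

Lemma exponential1_le c : 0 <= c -> P (X @^-1` `]-oo, c]) = (1 - expR (- c))%:E.
Proof.
move=> c0; rewrite -[LHS]/(distribution P X `]-oo, c]%classic).
rewrite (@itv_bndbnd_setU _ _ -oo%O (BLeft 0) (BRight c))//.
rewrite measureU//=; last first.
  apply/seteqP; split => // x [] /=; rewrite !in_itv/= => x0 /andP[].
  by rewrite leNgt x0.
rewrite [X in (X + _)%E](_ : _ = 0) ?add0e; last exact: exponential1_lt0.
(* For [c = 0] the remaining interval is the single point 0, a null set; the interval formula
   handles [0 < c]. *)
move: c0; rewrite le_eqVlt => /predU1P[<-|c0].
  by rewrite set_itv1 oppr0 expR0 subrr; exact: exponential1_set1.
by rewrite X_exp// exponential_prob_itv0c// mulN1r EFinB.
Qed.

(** Positivity is what the rate comparisons require, and avoiding [c] makes strict and weak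
    inequalities at the threshold interchangeable. *)
Lemma exponential1_ae_gt0 c : {ae P, forall t, 0 < X t /\ X t != c}.
Proof.
have mX B : measurable B -> measurable (X @^-1` B).
  by move=> mB; rewrite -[_ @^-1` _]setTI; apply: measurable_funPT.
exists (X @^-1` `]-oo, 0[ `|` X @^-1` [set 0] `|` X @^-1` [set c]); split.
- by do 2 ?[apply: measurableU]; apply: mX.
- have mU : measurable (X @^-1` `]-oo, 0[ `|` X @^-1` [set 0]) by apply: measurableU; apply: mX.
  rewrite !null_set_setU//; try exact: exponential1_set1; try exact: exponential1_lt0;
    by apply: mX.
- move=> t /= /not_andP[/negP|/negP]; last by rewrite negbK => /eqP; right.
  by rewrite -leNgt le_eqVlt => /orP[/eqP ?|?]; left; [right|left]; rewrite //= in_itv.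
Qed.

End Exponential.

(** * Reduction of the rate comparisons to a threshold *)

Section Rates.
Context (R : realType).

Lemma log2_half_lt (u v : R) : 0 < u -> 0 < v ->
  (1 / 2 * log2 v < log2 u) = (v < u ^+ 2).
Proof.
move=> u0 v0; have ln2 : 0 < ln (2 : R) by apply: ln_gt0; rewrite ltr1n.
rewrite /log2 mulrA ltr_pM2r ?invr_gt0// -ltr_ln ?posrE ?exprn_gt0//.
by rewrite lnXn//; apply/idP/idP; lra.
Qed.

(** The NOMA argument is [(1 + x) / (1 + a2 * x)]. The time fraction 1/2 amounts to squaring it,
    which leaves [(1 + a2 * x)^2 < 1 + x]; the difference of the two sides has the positive factor
    [x], and the other factor is linear with root [w2 a2]. *)
Lemma noma_rate1_gt (a2 x : R) : 0 < a2 -> 0 < x ->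
  (tdma_rate (1 / 2) x < noma_rate1 (1 - a2) a2 x) = (x < w2 a2).
Proof.
move=> a20 x0; rewrite /tdma_rate /noma_rate1 /w2.
have d0 : 0 < 1 + a2 * x by nra.
have -> : 1 + (1 - a2) * x / (1 + a2 * x) = (1 + x) / (1 + a2 * x).
  by field; rewrite gt_eqF.
rewrite log2_half_lt ?divr_gt0//; [|lra..].
rewrite expr_div_n ltr_pdivlMr ?exprn_gt0// ltr_pdivlMr ?exprn_gt0//.
rewrite expr2 mulrC [in ltRHS]expr2 ltr_pM2r; last by lra.
rewrite -subr_gt0 -[RHS]subr_gt0.
have -> : 1 + x - (1 + a2 * x) * (1 + a2 * x) = x * (1 - 2 * a2 - x * a2 ^+ 2) by ring.
by rewrite pmulr_rgt0.
Qed.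

Lemma noma_rate2_gt (a2 y : R) : 0 < a2 -> 0 < y ->
  (tdma_rate (1 / 2) y < noma_rate2 a2 y) = (w2 a2 < y).
Proof.
move=> a20 y0; rewrite /tdma_rate /noma_rate2 /w2.
rewrite log2_half_lt; [|nra..].
rewrite ltr_pdivrMr ?exprn_gt0// -subr_gt0 -[RHS]subr_gt0.
have -> : (1 + a2 * y) ^+ 2 - (1 + y) = y * (y * a2 ^+ 2 - (1 - 2 * a2)) by ring.
by rewrite pmulr_rgt0.
Qed.

End Rates.

(** * Formal integration of polynomials *)

Section FormalIntegral.
Variable K : numFieldType.
Implicit Types (d : K) (p q : {poly K}).

(* The integral of p over [0, d], computed formally on coefficients. *)
Definition integral0 d p : K :=
  \sum_(i < size p) p`_i * (d ^+ i.+1 / i.+1%:R).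

Lemma integral0_widen N d p : (size p <= N)%N ->
  integral0 d p = \sum_(i < N) p`_i * (d ^+ i.+1 / i.+1%:R).
Proof.
move=> spN; rewrite /integral0 (big_ord_widen N (fun i => p`_i * (d ^+ i.+1 / i.+1%:R)))//.
rewrite big_mkcond /=; apply: eq_bigr => i _; case: ltnP => // hi.
by rewrite nth_default// mul0r.
Qed.

Lemma integral0_is_linear d : linear_for *%R (integral0 d).
Proof.
move=> c p q; pose N := maxn (size (c *: p + q)) (maxn (size p) (size q)).
rewrite !(@integral0_widen N)/N ?leq_max ?leqnn ?orbT//.
rewrite mulr_sumr -big_split/=; apply: eq_bigr => i _.
by rewrite coefD coefZ; ring.
Qed.

HB.instance Definition _ d :=
  GRing.isLinear.Build K {poly K} K *%R (integral0 d) (integral0_is_linear d).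

Lemma integral0Xn d k : integral0 d 'X^k = d ^+ k.+1 / k.+1%:R.
Proof.
rewrite /integral0 size_polyXn big_ord_recr big1/= ?add0r; last first.
  by move=> i _; rewrite coefXn ltn_eqF ?mul0r.
by rewrite coefXn eqxx mul1r.
Qed.

(** Induction on [b] replaces integration by parts: splitting off one factor [d - X] expresses the
    integral for [(a, b.+1)] as [d] times that for [(a, b)] minus that for [(a.+1, b)]. *)
Lemma integral0_beta d a b :
  integral0 d ('X^a * (d%:P - 'X) ^+ b)
  = d ^+ (a + b).+1 * (a`! * b`!)%:R / ((a + b).+1)`!%:R.
Proof.
elim: b a => [|b IHb] a.
  rewrite mulr1 integral0Xn addn0 fact0 muln1 factS natrM.
  have : a`!%:R != 0 :> K by rewrite pnatr_eq0 -lt0n fact_gt0.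
  have : a.+1%:R != 0 :> K by rewrite pnatr_eq0.
  by move=> h1 h2; field; rewrite -nat1r in h1; rewrite h1 h2.
rewrite exprS mulrA mulrBr mulrBl raddfB/= -exprSr IHb.
rewrite (mulrC 'X^a) mul_polyC -scalerAl scalarZ/= IHb.
rewrite addSn addnS !exprS (factS (a + b).+1) (factS a) (factS b).
have : (a + b).+1`!%:R != 0 :> K by rewrite pnatr_eq0 -lt0n fact_gt0.
have : (a + b).+2%:R != 0 :> K by rewrite pnatr_eq0.
move: (a + b).+1`! a`! b`! => f fa fb.
rewrite !natrM -!natr1 !natrD => h f0.
by field; rewrite f0.
Qed.

Lemma integral0_sign d (k c : nat) p :
  integral0 d ((-1) ^+ k * c%:R * p) = (-1) ^+ k * c%:R * integral0 d p.
Proof.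
have -> : (-1) ^+ k * c%:R = ((-1) ^+ k * c%:R)%:P :> {poly K}.
  by rewrite polyCM rmorphXn rmorphN rmorph1 rmorph_nat.
by rewrite mul_polyC scalarZ.
Qed.

End FormalIntegral.

(** * Alternating binomial sums and the polynomial identity in [d] *)

Lemma exprB_sum (L : comNzRingType) b (x t : L) :
  (x - t) ^+ b =
  \sum_(j < b.+1) (-1) ^+ (b - j) * 'C(b, j)%:R * (x ^+ j * t ^+ (b - j)).
Proof.
rewrite addrC exprDn; apply: eq_bigr => j _.
by rewrite [(- t) ^+ _]exprNn -mulr_natr; ring.
Qed.

Section Identity.
Variable K : numFieldType.
Implicit Types (d : K).

(** In characteristic zero the naturals supply as many distinct roots of [p - q] as its size. *)
Lemma poly_eq_horner (p q : {poly K}) : (forall d, p.[d] = q.[d]) -> p = q.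
Proof.
move=> pq; apply/eqP; rewrite -subr_eq0; apply/eqP.
apply: (@roots_geq_poly_eq0 _ _ [seq i%:R | i <- iota 0 (size (p - q))]).
- by apply/allP => x _; rewrite rootE !hornerE pq subrr.
- rewrite map_inj_uniq ?iota_uniq// => i j /eqP; rewrite eqr_nat => /eqP//.
- by rewrite size_map size_iota.
Qed.

Lemma poly_eq_deriv (p q : {poly K}) :
  p.[0] = q.[0] -> p^`() = q^`() -> p = q.
Proof.
rewrite !horner_coef0 => pq0 /polyP pq; apply/polyP => -[//|i].
have := pq i; rewrite !coef_deriv => /eqP.
by rewrite eqrMn2r// => /eqP.
Qed.

Lemma integral0_beta1 a b :
  integral0 (1 : K) ('X^a * (1 - 'X) ^+ b)
  = (a`! * b`!)%:R / ((a + b).+1)`!%:R.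
Proof. by rewrite -polyC1 integral0_beta expr1n mul1r. Qed.

(** Both sides are the integral of [t^r (1-t)^m'] over [0, 1]: the left by expanding the power, the
    right by the Beta formula. *)
Lemma sum_alternating_inv r m' :
  \sum_(k < m'.+1) (-1) ^+ (m' - k) * 'C(m', k)%:R / (m' + r.+1 - k)%:R
  = (r`! * m'`!)%:R / ((r + m').+1)`!%:R :> K.
Proof.
rewrite -integral0_beta1 exprB_sum mulr_sumr raddf_sum; apply: eq_bigr => k _ /=.
rewrite expr1n mul1r mulrCA integral0_sign -exprD integral0Xn expr1n div1r.
by congr (_ * _ %:R^-1); have := ltn_ord k; lia.
Qed.

(* Write N.+1 / (N.+1 - j) = 1 + j / (N.+1 - j): the constant part sums to (1 - 1) ^ b.+1 = 0, and the factor j lowers b.+1 to b. *)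
Lemma sum_alternating_absorb b N : (b < N)%N ->
  \sum_(j < b.+2) (-1) ^+ (b.+1 - j) * 'C(b.+1, j)%:R * (N.+1%:R / (N.+1 - j)%:R)
  = b.+1%:R * \sum_(j < b.+1) (-1) ^+ (b - j) * 'C(b, j)%:R / (N - j)%:R :> K.
Proof.
move=> bN.
transitivity (\sum_(j < b.+2) (-1) ^+ (b.+1 - j) * 'C(b.+1, j)%:R * (j%:R / (N.+1 - j)%:R) : K).
  apply/eqP; rewrite -subr_eq0 -sumrB; apply/eqP.
  transitivity ((1 - 1) ^+ b.+1 : K); last by rewrite subrr expr0n.
  rewrite exprB_sum; apply: eq_bigr => j _; rewrite !expr1n -mulrBr -mulrBl.
  rewrite -natrB; last by have := ltn_ord j; lia.
  by rewrite divff ?mulr1// pnatr_eq0; have := ltn_ord j; lia.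
rewrite big_ord_recl mul0r mulr0 add0r mulr_sumr; apply: eq_bigr => j _.
rewrite /= /bump /= add1n !subSS mulrA -!mulrA [in RHS]mulrCA; congr (_ * _).
by rewrite !mulrA -!natrM mulnC mul_bin_diag.
Qed.

(** The exponent of [d] is free of [j]: expanding [(d - t)^b] gives [d^j] and lowers the power of
    [t] by the same [j]. *)
Lemma integral0_expand d s k b :
  integral0 d ('X^s * (1 - 'X) ^+ k * (d%:P - 'X) ^+ b) =
  \sum_(i < k.+1) \sum_(j < b.+1)
    (-1) ^+ (k - i) * 'C(k, i)%:R * ((-1) ^+ (b - j) * 'C(b, j)%:R) *
    (d ^+ ((k + b + s).+1 - i) / ((k + b + s).+1 - i - j)%:R).
Proof.
rewrite !exprB_sum -mulrA mulr_suml mulr_sumr raddf_sum; apply: eq_bigr => i _ /=.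
rewrite !mulr_sumr raddf_sum; apply: eq_bigr => j _ /=.
rewrite expr1n mul1r.
transitivity (integral0 d ((-1) ^+ (k - i) * 'C(k, i)%:R *
  ((-1) ^+ (b - j) * 'C(b, j)%:R *
     (d%:P ^+ j * ('X^s * 'X^(k - i) * 'X^(b - j)))))).
  by congr (integral0 d _); ring.
rewrite !integral0_sign -rmorphXn/= mul_polyC scalarZ/= -!exprD integral0Xn.
rewrite -!mulrA; do 4 congr (_ * _); rewrite mulrA -exprD.
by congr (_ ^+ _ / _%:R); have := ltn_ord i; have := ltn_ord j; lia.
Qed.

(** By [integral0_expand] the double sum is the integral of [t^s (1-t)^k (d-t)^(b+1)] over [0, d],
    so this is the Leibniz rule, the boundary term vanishing at [t = d]. It is proved termwise:
    differentiation brings down a factor [N.+1], which [sum_alternating_absorb] removes. *)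
Lemma deriv_integral0_difference d s k b :
  (\sum_(i < k.+1) \sum_(j < b.+2)
    ((-1) ^+ (k + b.+1 - i - j) * 'C(k, i)%:R * 'C(b.+1, j)%:R
       / ((k + b + s).+2 - i - j)%:R) *: 'X^((k + b + s).+2 - i))^`().[d]
  = b.+1%:R * integral0 d ('X^s * (1 - 'X) ^+ k * (d%:P - 'X) ^+ b).
Proof.
rewrite integral0_expand raddf_sum horner_sum mulr_sumr; apply: eq_bigr => i _ /=.
have ik : (i <= k)%N by have := ltn_ord i; lia.
have -> : ((k + b + s).+2 - i = ((k + b + s).+1 - i).+1)%N by lia.
set N := ((k + b + s).+1 - i)%N.
transitivity ((-1) ^+ (k - i) * 'C(k, i)%:R * d ^+ N *
    (\sum_(j < b.+2) (-1) ^+ (b.+1 - j) * 'C(b.+1, j)%:R * (N.+1%:R / (N.+1 - j)%:R))).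
  rewrite raddf_sum horner_sum mulr_sumr; apply: eq_bigr => j _ /=.
  have jb : (j <= b.+1)%N by have := ltn_ord j; lia.
  rewrite derivZ derivXn hornerZ hornerMn hornerXn /= -mulr_natr.
  have -> : (k + b.+1 - i - j = (k - i) + (b.+1 - j))%N by lia.
  rewrite exprD; ring.
rewrite sum_alternating_absorb; last by rewrite /N; lia.
rewrite mulrCA; congr (_ * _); rewrite mulr_sumr; apply: eq_bigr => j _.
by ring.
Qed.

(** The polynomial is the integral of [t^s (1-t)^q] over [0, d], so its derivative is the integrand
    at [d]. *)
Lemma deriv_integral0_endpoint d s q :
  (\sum_(i < q.+1) ((-1) ^+ (q - i) * 'C(q, i)%:R / ((q + s).+1 - i)%:R)
     *: 'X^((q + s).+1 - i))^`().[d] = d ^+ s * (1 - d) ^+ q.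
Proof.
rewrite raddf_sum horner_sum exprB_sum mulr_sumr; apply: eq_bigr => i _ /=.
have iq : (i <= q)%N by have := ltn_ord i; lia.
have -> : ((q + s).+1 - i = (s + (q - i)).+1)%N by lia.
rewrite derivZ derivXn hornerZ hornerMn hornerXn /= -[_ ^+ _ *+ _]mulr_natr expr1n mul1r exprD.
have : (s + (q - i)).+1%:R != 0 :> K by rewrite pnatr_eq0.
by move: _.+1%:R => N N0; field.
Qed.

(** Under the integral, the sum over [k] is the binomial expansion of
    [((1-t) - (d-t))^m' = (1-d)^m'], constant in [t]; the Beta integral of [t^s (d-t)^r] remains. *)
Lemma sum_integral0_difference d s m' r :
  \sum_(k < m'.+1) (-1) ^+ (m' - k) * 'C(m', k)%:R *
     integral0 d ('X^s * (1 - 'X) ^+ k * (d%:P - 'X) ^+ (m' + r - k))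
  = (1 - d) ^+ m' * d ^+ (s + r).+1 * (s`! * r`!)%:R / ((s + r).+1)`!%:R.
Proof.
have e : 'X^s * (d%:P - 'X) ^+ r * ((1 - 'X) - (d%:P - 'X)) ^+ m' =
    (1 - d) ^+ m' *: ('X^s * (d%:P - 'X) ^+ r) :> {poly K}.
  by rewrite opprB addrA subrK -polyC1 -polyCB -rmorphXn/= mulrC mul_polyC.
have := congr1 (integral0 d) e; rewrite scalarZ/= integral0_beta.
rewrite -!mulrA => <-; rewrite [(_ - _ - _) ^+ _]exprB_sum !mulr_sumr raddf_sum.
apply: eq_bigr => k _ /=; rewrite mulrA -integral0_sign; congr (integral0 d _).
have -> : (m' + r - k = r + (m' - k))%N by have := ltn_ord k; lia.
by rewrite exprD; ring.
Qed.

Lemma deriv_binomial_window d M m n : (m <= n)%N -> (n <= M)%N ->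
  (\sum_(m <= l < n) 'C(M, l)%:R *: ((1 - 'X) ^+ l * 'X^(M - l)))^`().[d]
  = (n * 'C(M, n))%:R * (1 - d) ^+ n.-1 * d ^+ (M - n)
    - (m * 'C(M, m))%:R * (1 - d) ^+ m.-1 * d ^+ (M - m).
Proof.
move=> mn nM.
(* The derivative of the [l]-th summand is [T l.+1 - T l], because
   [l.+1 * 'C(M, l.+1) = (M - l) * 'C(M, l)]. *)
pose T l : K := (l * 'C(M, l))%:R * (1 - d) ^+ l.-1 * d ^+ (M - l).
rewrite -[RHS]/(T n - T m) -telescope_sumr// raddf_sum horner_sum.
apply: eq_big_nat => l /andP[ml ln] /=.
rewrite derivZ derivM derivXn deriv_exp derivB derivX -polyC1 derivC.
rewrite hornerZ hornerD !hornerM !hornerMn !hornerM horner_exp !hornerE /T.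
rewrite mul_bin_left -subnS !natrM -[_ *+ l]mulr_natr -[_ *+ (M - l)]mulr_natr.
ring.
Qed.

Lemma mul_bin_fact M n : (0 < n)%N -> (n <= M)%N ->
  (n * 'C(M, n))%:R = M`!%:R / (n.-1`! * (M - n)`!)%:R :> K.
Proof.
case: n => // n _ nM; rewrite -(bin_fact nM) factS.
apply: (canRL (mulfK _)); last by rewrite -natrM/=; congr _%:R; lia.
by rewrite pnatr_eq0 -lt0n muln_gt0 !fact_gt0.
Qed.

Lemma binomial_window_identity d M m n : (0 < m)%N -> (m < n)%N -> (n <= M)%N ->
  \sum_(m <= l < n) 'C(M, l)%:R * ((1 - d) ^+ l * d ^+ (M - l)) =
  M`!%:R / ((m - 1)`!%:R * (n - 1 - m)`!%:R * (M - n)`!%:R) *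
  \sum_(0 <= k < m)
     (-1) ^+ (m - 1 - k) * 'C(m - 1, k)%:R / (n - 1 - k)%:R *
     (\sum_(0 <= i < n)
        (-1) ^+ (n - 1 - i) * 'C(n - 1, i)%:R * d ^+ (M - i) / (M - i)%:R
      - \sum_(0 <= i < k.+1) \sum_(0 <= j < (n - k)%N)
          (-1) ^+ (n - 1 - i - j) * 'C(k, i)%:R * 'C(n - 1 - k, j)%:R
            * d ^+ (M - i) / (M - i - j)%:R).
Proof.
(* With [m = m'.+1], the gaps [r = n - m - 1] and [s = M - n] remove truncated subtraction from the
   exponents. *)
case: m => // m' _ m'n nM.
have [r [s [en eM]]] : exists r s, n = (m' + r).+2 /\ M = (m' + r + s).+2.
  by exists (n - m'.+2)%N, (M - n)%N; split; lia.
set w := M`!%:R / _.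
pose PL : {poly K} := \sum_(m'.+1 <= l < n) 'C(M, l)%:R *: ((1 - 'X) ^+ l * 'X^(M - l)).
pose PA : {poly K} := \sum_(i < n)
  ((-1) ^+ (n - 1 - i) * 'C(n - 1, i)%:R / (M - i)%:R) *: 'X^(M - i).
pose PB (k : nat) : {poly K} := \sum_(i < k.+1) \sum_(j < n - k)
    ((-1) ^+ (n - 1 - i - j) * 'C(k, i)%:R * 'C(n - 1 - k, j)%:R
       / (M - i - j)%:R) *: 'X^(M - i).
pose c (k : nat) : K := (-1) ^+ (m' - k) * 'C(m', k)%:R.
pose PR : {poly K} := w *: \sum_(k < m'.+1) (c k / (n - 1 - k)%:R) *: (PA - PB k).
have dA x : PA^`().[x] = x ^+ s * (1 - x) ^+ (m' + r).+1.
  by rewrite -deriv_integral0_endpoint /PA en eM !subSS subn0 addSn.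
have dB (k : 'I_m'.+1) x : (PB k)^`().[x] = (n - 1 - k)%:R *
    integral0 x ('X^s * (1 - 'X) ^+ k * (x%:P - 'X) ^+ (m' + r - k)).
  have km : (k <= m')%N by have := ltn_ord k; lia.
  have -> : (n - 1 - k = (m' + r - k).+1)%N by lia.
  rewrite -deriv_integral0_difference /PB.
  have -> : (n - 1 - k = (m' + r - k).+1)%N by lia.
  have -> : (n - k = (m' + r - k).+2)%N by lia.
  have -> : (n - 1 = k + (m' + r - k).+1)%N by lia.
  by have -> : (M = (k + (m' + r - k) + s).+2)%N by lia.
suff PLR : PL = PR.
  transitivity PL.[d].
    rewrite /PL horner_sum; apply: eq_bigr => l _.
    by rewrite hornerZ hornerM hornerXn horner_exp !hornerE.
  rewrite PLR /PR hornerZ horner_sum big_mkord; congr (_ * _).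
  apply: eq_bigr => k _; rewrite hornerZ hornerD hornerN.
  congr (_ * (_ - _)).
    have -> : (m'.+1 - 1 = m')%N by lia.
    by [].
    rewrite /PA horner_sum big_mkord; apply: eq_bigr => i _.
    by rewrite hornerZ hornerXn mulrAC.
  rewrite /PB horner_sum big_mkord; apply: eq_bigr => i _.
  rewrite horner_sum big_mkord; apply: eq_bigr => j _.
  by rewrite hornerZ hornerXn mulrAC.
apply: poly_eq_deriv.
  (* Every exponent of [d] on either side is some [M - i] with [i < n <= M], hence positive. *)
  have h0 i : (i < n)%N -> (0 : K) ^+ (M - i) = 0.
    by move=> ?; rewrite expr0n; case: eqP => //; lia.
  transitivity (0 : K).
    rewrite /PL horner_sum big_nat big1// => l /andP[_ ln].
    by rewrite hornerZ hornerM hornerXn h0// !mulr0.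
  rewrite /PR hornerZ horner_sum big1 ?mulr0// => k _.
  rewrite hornerZ hornerD hornerN /PA /PB !horner_sum !big1 ?subr0 ?mulr0//.
    move=> i _; rewrite horner_sum big1// => j _; rewrite hornerZ hornerXn h0 ?mulr0//.
    by have := ltn_ord i; have := ltn_ord k; lia.
  by move=> i _; rewrite hornerZ hornerXn h0 ?mulr0.
apply: poly_eq_horner => x.
rewrite deriv_binomial_window//; last by lia.
rewrite /PR derivZ hornerZ raddf_sum horner_sum /=.
under eq_bigr => k _.
  rewrite derivZ derivB hornerZ hornerD hornerN dA dB.
  have nk : (n - 1 - k)%:R != 0 :> K.
    by rewrite pnatr_eq0; have := ltn_ord k; lia.
  (* The factor [n - 1 - k] from differentiating [PB k] cancels the outer denominator, so only the
     [PA] part keeps it. *)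
  rewrite mulrBr [c k / _ * (_%:R * _)]mulrA divfK//.
  over.
rewrite big_split/= -mulr_suml sumrN sum_integral0_difference.
have -> : \sum_(k < m'.+1) c k / (n - 1 - k)%:R = (r`! * m'`!)%:R / (r + m').+1`!%:R.
  by rewrite -sum_alternating_inv; apply: eq_bigr => k _; congr (_ / _%:R); lia.
have f0 i : i`!%:R != 0 :> K by rewrite pnatr_eq0 -lt0n fact_gt0.
have m'M : (m' < M)%N by lia.
rewrite !mul_bin_fact//; last by lia.
rewrite /w.
have -> : (M - n = s)%N by lia.
have -> : (M - m'.+1 = (s + r).+1)%N by lia.
have -> : (n - 1 - m'.+1 = r)%N by lia.
have -> : (m'.+1 - 1 = m')%N by lia.
have -> : (n.-1 = (m' + r).+1)%N by lia.
have -> : (m'.+1.-1 = m')%N by [].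
rewrite (addnC r m').
have := f0 m'; have := f0 r; have := f0 s.
have := f0 (m' + r).+1; have := f0 (s + r).+1.
move: m'`! r`! s`! M`! (m' + r).+1`! (s + r).+1`! => fm fr fs fM fq ft h1 h2 h3 h4 h5.
rewrite !natrM.
field.
by rewrite h1 h2 h3 h4 h5.
Qed.

End Identity.

(** * The probability of the event *)

Lemma probability_window (R : realType) (disp : measure_display)
    (T : measurableType disp) (P : probability T R) (M m n : nat) (c : R)
    (G : 'I_M -> {RV P >-> R}) :
  (n <= M)%N -> 0 <= c -> iid_exponential1 G ->
  P [set t | (m <= #|below G c t| < n)%N] =
  (\sum_(m <= l < n) 'C(M, l)%:R *
     ((1 - expR (- c)) ^+ l * expR (- c) ^+ (M - l)))%:E.
Proof.
move=> nM c0 [indG expG].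
have Gc i : P (G i @^-1` `]-oo, c]) = (1 - expR (- c))%:E.
  by apply: exponential1_le c0 => B; exact: expG.
rewrite (probability_below (fun S : {set 'I_M} => (m <= #|S| < n)%N) indG Gc).
rewrite (sum_set_card (fun l => (1 - expR (- c)) ^+ l *
  (1 - (1 - expR (- c))) ^+ (M - l)) m); last by rewrite card_ord ltnW.
congr (_%:E); apply: eq_bigr => l _.
by rewrite card_ord subKr mulr_natl.
Qed.

Lemma measurable_rates (R : realType) (disp : measure_display)
    (T : measurableType disp) (a1 a2 b1 b2 : R) (x y : T -> R) :
  measurable_fun setT x -> measurable_fun setT y ->
  measurable [set t | noma_rate1 a1 a2 (x t) > tdma_rate b1 (x t) /\
                      noma_rate2 a2 (y t) > tdma_rate b2 (y t)].
Proof.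
move=> mx my.
have mlog (f : T -> R) : measurable_fun setT f -> measurable_fun setT (fun t => log2 (1 + f t)).
  move=> mf; rewrite /log2; apply: measurable_funM => //.
  apply: (measurableT_comp (@measurable_ln R)).
  exact: measurable_funD.
have mscale (k : R) (f : T -> R) : measurable_fun setT f -> measurable_fun setT (fun t => k * f t).
  by move=> mf; exact: measurable_funM.
have mlt (f g : T -> R) : measurable_fun setT f -> measurable_fun setT g ->
    measurable [set t | f t < g t].
  by move=> mf mg; rewrite -[X in measurable X]setTI; exact: (measurable_fun_ltr mf mg).
apply: measurableI; apply: mlt.
- by apply: mscale; exact: mlog.
- apply: (mlog (fun t => a1 * x t / (1 + a2 * x t))).
  apply: measurable_funM; first exact: mscale.
  apply: measurable_fun_inv; apply: measurable_funD => //; exact: mscale.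
- by apply: mscale; exact: mlog.
- by apply: (mlog (fun t => a2 * y t)); exact: mscale.
Qed.

Theorem lemma1 (R : realType) (disp : measure_display) (T : measurableType disp)
    (P : probability T R) (M m n : nat)
    (h1m : (1 <= m)%N) (hmn : (m < n)%N) (hnM : (n <= M)%N)
    (rho : R) (hrho : 0 < rho)
    (a1 a2 b1 b2 : R) (ha2 : 0 < a2) (ha2_half : a2 <= 1 / 2)
    (ha1 : a1 = 1 - a2) (hb1 : b1 = 1 / 2) (hb2 : b2 = 1 / 2)
    (G : 'I_M -> {RV P >-> R}) (hG : iid_exponential1 G) :
  let x := fun t : T => rho * order_stat G m t in
  let y := fun t : T => rho * order_stat G n t in
  let d := expR (- w2 a2 / rho) in
  P [set t | noma_rate1 a1 a2 (x t) > tdma_rate b1 (x t) /\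
             noma_rate2 a2 (y t) > tdma_rate b2 (y t)] =
  (w1 R M m n *
   \sum_(0 <= k < m)
     (-1) ^+ (m - 1 - k) * 'C(m - 1, k)%:R / (n - 1 - k)%:R *
     (\sum_(0 <= i < n)
        (-1) ^+ (n - 1 - i) * 'C(n - 1, i)%:R * d ^+ (M - i) / (M - i)%:R
      - \sum_(0 <= i < k.+1) \sum_(0 <= j < (n - k)%N)
          (-1) ^+ (n - 1 - i - j) * 'C(k, i)%:R * 'C(n - 1 - k, j)%:R
            * d ^+ (M - i) / (M - i - j)%:R))%:E.
Proof.
move=> x y d.
have m0 : (0 < m)%N by [].
have mM : (m <= M)%N by lia.
have n0 : (0 < n)%N by lia.
pose c := w2 a2 / rho.
(* Here [a2 <= 1/2] is used: it makes the numerator of [w2 a2] nonnegative. *)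
have c0 : 0 <= c.
  by rewrite divr_ge0 ?(ltW hrho)// divr_ge0 ?sqr_ge0//; lra.
have wE : w2 a2 = rho * c by rewrite mulrC divfK// gt_eqF.
have mx : measurable_fun setT x.
  by apply: measurable_funM => //; exact: measurable_order_stat.
have my : measurable_fun setT y.
  by apply: measurable_funM => //; exact: measurable_order_stat.
rewrite /w1 -binomial_window_identity//.
have -> : d = expR (- c) by rewrite /d mulNr.
rewrite -(probability_window m hnM c0 hG).
apply: measure_ae_eq.
- exact: measurable_rates.
- exact: (measurable_belowP G c (fun S => (m <= #|S| < n)%N)).
(* There are finitely many gains, so a single null set serves all of them. *)
have : {ae P, forall t i, 0 < G i t /\ G i t != c}.
  apply: filter_forall => i; apply: exponential1_ae_gt0 => B; exact: hG.2.
apply: filterS => t Gt /=.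
have [i xi] := order_stat_mem G t m0 mM.
have [j yj] := order_stat_mem G t n0 hnM.
have [Gi0 Gic] := Gt i; have [Gj0 Gjc] := Gt j.
have x0 : 0 < x t by rewrite /x xi mulr_gt0.
have y0 : 0 < y t by rewrite /y yj mulr_gt0.
rewrite ha1 hb1 hb2 noma_rate1_gt// noma_rate2_gt// wE /x /y !ltr_pM2l//.
(* Since no gain equals [c], the strict bound on the [m]-th gain becomes weak and says
   [m <= #|below G c t|]; the bound on the [n]-th is the negation of [n <= #|below G c t|]. *)
rewrite lt_neqAle xi Gic -xi order_stat_le// ltNge order_stat_le// -ltnNge.
by split=> [[/= -> ->]|/andP[]].
Qed.
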